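(* Let $X$ be a Peano continuum without cut points, $G$ a group acting on $X$ by homeomorphisms, and $\mathcal{A}$ a $G$-invariant collection of closed subsets of $X$ such that $(G,\mathcal{A})$ is a local convergence pairing on $X$. Then $G$ acts as a convergence group on $X$.
   Context: A Peano continuum is a compact, connected, locally connected metric space. For a closed set $S\subset X$ and connected sets $B,C\subset X\setminus S$, $S$ separates $B$ from $C$ if $B$ and $C$ lie in different components of $X\setminus S$; $S$ separates a set $Y$ if it separates two points of $Y$. Closed sets $A,B$ cross if either $A\cap B\neq\emptyset$, or $A$ separates $B$ and $B$ separates $A$. A crossing sequence from $A_1$ to $A_n$ is a sequence $A_1,\dots,A_n$ with $A_i$ crossing $A_{i+1}$ for all $1\le i<n$. For a group acting by homeomorphisms on a space $Y$, a sequence $(g_i)$ acts as a convergence sequence on $Y$ if there are $n,p\in Y$ (repeller, attractor; possibly equal) such that for every compact $C\subset Y$ with $n\notin C$, $g_i(C)\to p$ (i.e. for each neighborhood $U$ of $p$, $g_i(C)\subset U$ for all large $i$); the group acts as a convergence group on $Y$ if every sequence of distinct elements has a subsequence acting as a convergence sequence on $Y$. The pair $(G,\mathcal{A})$ is a local convergence pairing on $X$ if: (1) $|A|>2$ for all $A\in\mathcal{A}$; (2) $\mathcal{A}$ is null: for each $\epsilon>0$ only finitely many $A\in\mathcal{A}$ have $\operatorname{diam}(A)>\epsilon$; (3) $\mathcal{A}$ is fine: for any $x,y\in X$ there is a finite $\mathcal{B}\subset\mathcal{A}$ with $\bigcup\mathcal{B}$ separating $x$ from $y$; (4) for each $A\in\mathcal{A}$,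 $\mathrm{Stab}(A)=\{g\in G:g(A)=A\}$ acts as a convergence group on $A$; (5) for any $A,B\in\mathcal{A}$ with $|A\cap B|\le 2$: if $A\cap B=\{c\}$ then for any $b\in B\setminus\{c\}$ there is a finite crossing sequence $A,A_1,\dots,A_n,B$ in $\mathcal{A}$ with $D\cap A_i=\emptyset$ for all $1\le i\le n$, where $D=\{b,c\}$; and if $|A\cap B|\neq 1$ then there is a crossing sequence $A,A_1,\dots,A_n,B$ in $\mathcal{A}$ with $D\cap A_i=\emptyset$ for all $1\le i\le n$, where $D=A\cap B$. *)

(* Defs.v *)
From HB Require Import structures.
From mathcomp Require Import all_boot all_order all_algebra.
From mathcomp Require Import all_classical all_reals all_analysis.
Set Implicit Arguments. Unset Strict Implicit. Unset Printing Implicit Defensive.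
Import Order.TTheory GRing.Theory Num.Theory.
Local Open Scope classical_set_scope.
Local Open Scope ring_scope.

Section Defs.
Context {R : realType} {X : metricType R}.

Definition locally_connected_space : Prop :=
  forall (x : X) (U : set X), nbhs x U ->
    exists V : set X, [/\ open V, connected V, V x & V `<=` U].

Definition peano_continuum : Prop :=
  [/\ [set: X] !=set0, compact [set: X], connected [set: X] & locally_connected_space].

Definition cut_point (x : X) : Prop := ~ connected (~` [set x]).

Definition diam (A : set X) : R :=
  sup [set d | exists x y, [/\ A x, A y & d = mdist x y]].

Definition separates_from (S B C : set X) : Prop :=
  [/\ B `<=` ~` S, C `<=` ~` S, B !=set0, C !=set0 &
      forall b c, B b -> C c -> ~ connected_component (~` S) b c].

Definition separates (S Y : set X) : Prop :=
  exists y1 y2, [/\ Y y1, Y y2 & separates_from S [set y1] [set y2]].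

Definition crosses (A B : set X) : Prop :=
  (A `&` B !=set0) \/ (separates A B /\ separates B A).

Fixpoint crossing_chain (x : set X) (l : seq (set X)) : Prop :=
  match l with
  | [::] => True
  | y :: l' => crosses x y /\ crossing_chain y l'
  end.

Definition crossing_seq_avoiding (AA : set (set X)) (A B D : set X) : Prop :=
  exists s : seq (set X),
    [/\ (0 < size s)%N,
        (forall Ai, Ai \in s -> AA Ai /\ D `&` Ai = set0) &
        crossing_chain A (rcons s B)].

End Defs.

Section Action.
Context {R : realType} {X : metricType R} {G : groupType}.
Variable act : G -> X -> X.

Definition convergence_seq_on (Y : set X) (g : nat -> G) : Prop :=
  exists n p : X, [/\ Y n, Y p &
    forall C : set X, C `<=` Y -> compact C -> ~ C n ->
      forall U : set X, nbhs p U ->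
        exists N : nat, forall i : nat, (N <= i)%N -> act (g i) @` C `<=` U `&` Y].

Definition convergence_group_on (H : set G) (Y : set X) : Prop :=
  forall g : nat -> G, (forall i, H (g i)) -> injective g ->
    exists phi : nat -> nat, (forall m n, (m < n)%N -> (phi m < phi n)%N) /\
      convergence_seq_on Y (g \o phi).

Definition Stab (A : set X) : set G := [set g | act g @` A = A].

Definition local_convergence_pairing (AA : set (set X)) : Prop :=
  [/\ (* (1) *) (forall A, AA A -> exists a b c : X,
                   [/\ A a, A b, A c & [/\ a <> b, b <> c & a <> c]]),
      (* (2) null *) (forall eps : R, 0 < eps -> finite_set [set A | AA A /\ eps < diam A]),
      (* (3) fine *) (forall x y : X, x <> y -> exists BB : set (set X),
                   [/\ finite_set BB, BB `<=` AA &
                       separates_from (\bigcup_(B in BB) B) [set x] [set y]]),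
      (* (4) *) (forall A, AA A -> convergence_group_on (Stab A) A) &
      (* (5) *) (forall A B, AA A -> AA B ->
          ((forall c : X, A `&` B = [set c] ->
              forall b : X, B b -> b <> c ->
                crossing_seq_avoiding AA A B [set b; c]) /\
           ((A `&` B = set0 \/ exists c1 c2 : X, c1 <> c2 /\ A `&` B = [set c1; c2]) ->
              crossing_seq_avoiding AA A B (A `&` B))))].

End Action.

(* Main.v *)
Require Import Defs.
From HB Require Import structures.
From mathcomp Require Import all_boot all_order all_algebra.
From mathcomp Require Import all_classical all_reals all_analysis.
Set Implicit Arguments. Unset Strict Implicit. Unset Printing Implicit Defensive.
Import Order.TTheory GRing.Theory Num.Theory.
Local Open Scope classical_set_scope.
Local Open Scope ring_scope.

(** Fix an injective sequence [g].  By nullness and condition (4), after passing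
to a subsequence a given [A] is either collapsed by [g] to a point [p], or
carried onto a constant set on which [g] is a convergence sequence with repeller
[n] and attractor [p].  Two small sets near distinct points do not link, so
crossing sets that are both collapsed have the same attractor.  The only
obstruction in the other cases is that the sets meet only at repellers.
Condition (5) removes it: take [D] containing the repellers and the limit [r] of
the preimages [g_i^-1 q] of the attractor [q] of one of the sets; any
non-collapsed set of the crossing sequence would have to contain [r], so all of
them collapse to [q].
Hence there is one attractor [p], and, applying this to inverses, one repeller
[n].  If [z <> p] and [g_i^-1 z] tends to [n] while [y_i] tends to [y <> n], then
finitely many members of the family separate [n] from [y]; none of them contains
[n], so they all collapse to [p].  As [p] is not a cut point, [g_i y_i] can be
joined to [z] away from [p] unless it tends to [p], and pulling back this
connection contradicts the separation. *)

(** * Extraction of subsequences *)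

Section Subsequences.

Lemma extraction_ge (phi : nat -> nat) :
  {homo phi : m n / (m < n)%N} -> forall n, (n <= phi n)%N.
Proof. by move=> hphi; elim=> // n /leq_ltn_trans; apply; exact: hphi. Qed.

Lemma extraction_inj (phi : nat -> nat) :
  {homo phi : m n / (m < n)%N} -> injective phi.
Proof.
move=> hphi i j /eqP; have [/hphi|/hphi|//] := ltngtP i j.
  by rewrite ltn_neqAle => /andP[/negbTE ->].
by rewrite ltn_neqAle eq_sym => /andP[/negbTE ->].
Qed.

Lemma near_extraction (phi : nat -> nat) (P : nat -> Prop) :
  {homo phi : m n / (m < n)%N} ->
  (\forall i \near \oo, P i) -> \forall i \near \oo, P (phi i).
Proof.
move=> hphi [N _ HN]; exists N => // i /= Ni.
by apply: HN => /=; apply: leq_trans Ni (extraction_ge hphi i).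
Qed.

(** The property may vary with [k], as diagonal choices require; each index is picked beyond the
    previous one. *)
Lemma extraction_dep (P : nat -> nat -> Prop) :
  (forall k N, exists2 i, (N <= i)%N & P k i) ->
  exists2 phi : nat -> nat,
    {homo phi : m n / (m < n)%N} & forall k, P k (phi k).
Proof.
move=> hP.
have [|f Hf] :=
    @choice (nat * nat) nat (fun kN i => (kN.2 <= i)%N /\ P kN.1 i).
  by move=> [k N]; have [i] := hP k N; exists i.
pose fix phi k := if k is k'.+1 then f (k, (phi k').+1) else f (0%N, 0%N).
exists phi; last first.
  by case=> [|k]; [exact: (Hf (0, 0)%N).2 | exact: (Hf (k.+1, _)).2].
by apply: homo_ltn; [exact: ltn_trans | move=> k; exact: (Hf (k.+1, _)).1].
Qed.

Lemma extraction (P : nat -> Prop) :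
  ~ (\forall i \near \oo, ~ P i) ->
  exists2 phi : nat -> nat,
    {homo phi : m n / (m < n)%N} & forall k, P (phi k).
Proof.
move=> hP; apply: (@extraction_dep (fun _ => P)) => _ N.
apply: contrapT => h; apply: hP; exists N => // i /= Ni Pi.
by apply: h; exists i.
Qed.

End Subsequences.

(** * Separation and sequential compactness *)

Section MetricTopology.
Context {R : realType} {X : metricType R}.

Lemma disjoint_nbhs (p q : X) : p <> q ->
  exists U V : set X, [/\ nbhs p U, nbhs q V & U `&` V = set0].
Proof.
move=> pq; apply: contrapT => h; apply: pq; apply: metric_hausdorff.
move=> U V pU qV; apply/set0P/eqP => UV; apply: h.
by exists U, V.
Qed.

Lemma nbhs_neq (p q : X) : p <> q -> nbhs p (~` [set q]).
Proof.
move=> /disjoint_nbhs[U [V [pU qV UV]]].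
apply: filterS pU => x Ux /= xq; rewrite {}xq in Ux.
have : (U `&` V) q by split => //; exact: nbhs_singleton.
by rewrite UV.
Qed.

Lemma compact_subsequence (C : set X) (u : nat -> X) :
  compact C -> (forall i, C (u i)) ->
  exists2 phi : nat -> nat, {homo phi : m n / (m < n)%N} &
    exists2 p, C p & (u \o phi) @ \oo --> p.
Proof.
move=> cC Cu.
have [|p [Cp clp]] := cC (u @ \oo) _ _.
  by exists 0%N => // i _; exact: Cu.
have [|phi hphi hp] := @extraction_dep (fun k i => ball p k.+1%:R^-1 (u i)).
  move=> k N.
  have [_ [[i /= Ni <-] Bi]] : (u @` [set i | (N <= i)%N]) `&`
      ball p k.+1%:R^-1 !=set0.
    apply: clp; last by apply: nbhsx_ballx; rewrite invr_gt0 ltr0n.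
    by exists N => // i /= Ni; exists i.
  by exists i.
exists phi => //; exists p => //; apply/cvg_ballP => e e0.
near=> k; apply: le_ball (hp k); apply: ltW.
by near: k; exact: (near_infty_natSinv_lt (PosNum e0)).
Unshelve. all: by end_near. Qed.

End MetricTopology.

Lemma near_finite_set {T : eqType} (A : set T) (P : T -> nat -> Prop) :
  finite_set A -> (forall a, A a -> \forall i \near \oo, P a i) ->
  \forall i \near \oo, forall a, A a -> P a i.
Proof.
move=> /finite_seqP[s ->]; elim: s => [|a s IHs] hs.
  by apply: nearW => i a.
have h1 := hs a (mem_head _ _).
have h2 : \forall i \near \oo, forall a, [set` s] a -> P a i.
  by apply: IHs => b bs; apply: hs; rewrite /= inE [b \in s]bs orbT.
apply: filterS2 h1 h2 => i h1 h2 b; rewrite /= inE => /orP[/eqP ->//|bs].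
exact: h2.
Qed.

(** * Local connectedness, cut points and crossing *)

Section Connectedness.
Context {R : realType} {X : metricType R}.
Hypothesis lcX : locally_connected_space (X := X).

(** The points [w] reached in this way form a nonempty relatively clopen subset of the connected
    complement of [p]. Whole neighborhoods of [w] and [p] are asked for because sequences will only
    approach these points. *)
Lemma connected_avoiding (p z w : X) : ~ cut_point p -> z <> p -> w <> p ->
  exists K : set X, [/\ connected K, K z, nbhs w K &
    exists2 U, nbhs p U & U `&` K = set0].
Proof.
move=> /contrapT cp zp wp.
pose good (K : set X) (x : X) := [/\ connected K, K z, nbhs x K &
  exists2 U, nbhs p U & U `&` K = set0].
pose E := [set w | exists K, good K w].
have small x : x <> p -> exists V, [/\ open V, connected V, V x &
    exists2 U, nbhs p U & U `&` V = set0].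
  move=> /disjoint_nbhs[V [U [xV pU VU]]].
  have [W [oW cW Wx WV]] := lcX xV.
  exists W; split=> //; exists U => //.
  by rewrite -subset0 => y [Uy /WV Vy]; rewrite -VU.
suff EE : E = ~` [set p] by have : E w by rewrite EE.
have EC : E `<=` ~` [set p].
  move=> x [K [_ _ /nbhs_singleton Kx [U /nbhs_singleton Up UK]]] /= xp.
  by have : (U `&` K) p; [split; rewrite // -xp | rewrite UK].
apply: cp.
- exists z; have [V [oV cV Vz UV]] := small _ zp.
  by exists V; split => //; exact: open_nbhs_nbhs.
- exists E; last by rewrite setIidr.
  rewrite openE => x [K [cK Kz /nbhs_interior xK UK]].
  by apply: filterS xK => y Ky; exists K.
- exists (closure E); first exact: closed_closure.
  apply/seteqP; split=> [x Ex|x [/= xp clEx]].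
    by split; [exact: EC | exact: subset_closure].
  have [V [oV cV Vx [U pU UV]]] := small _ xp.
  have xV : nbhs x V by exact: open_nbhs_nbhs.
  have [y [[K [cK Kz /nbhs_singleton Ky [U' pU' UK]]] Vy]] := clEx _ xV.
  exists (K `|` V); split.
  + by apply: connectedU => //; exists y.
  + by left.
  + by apply: filterS xV => t; right.
  + exists (U `&` U'); first exact: filterI.
    rewrite -subset0 => t [[Ut U't] [Kt|Vt]]; first by rewrite -UK.
    by rewrite -UV.
Qed.

Lemma nbhs_connected_component (A : set X) (x : X) :
  closed A -> ~ A x -> nbhs x (connected_component (~` A) x).
Proof.
move=> clA Ax.
have [V [oV cV Vx VA]] := lcX (open_nbhs_nbhs (conj (closed_openC clA) Ax)).
have xV : nbhs x V by exact: open_nbhs_nbhs.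
by apply: filterS xV; exact: connected_component_max.
Qed.

Lemma separates_points (S Y : set X) : separates S Y ->
  exists y1 y2, [/\ Y y1, Y y2, ~ S y1, ~ S y2 &
    ~ connected_component (~` S) y1 y2].
Proof.
move=> [y1 [y2 [Yy1 Yy2 [h1 h2 _ _ h]]]]; exists y1, y2; split => //.
- exact: h1.
- exact: h2.
- exact: h.
Qed.

Lemma crossesC (A B : set X) : crosses A B -> crosses B A.
Proof.
by move=> [AB|[AB BA]]; [left; rewrite setIC | right].
Qed.

End Connectedness.

(** * Collapse of a set to a point *)

Section Tends.
Context {R : realType} {X : metricType R} {G : groupType}.
Variable act : G -> X -> X.

Definition tends (g : nat -> G) (C : set X) (p : X) : Prop :=
  forall U, nbhs p U -> \forall i \near \oo, act (g i) @` C `<=` U.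

Lemma tends_sub g C D p : D `<=` C -> tends g C p -> tends g D p.
Proof.
move=> DC gC U /gC; apply: filterS => i CU _ [y Dy <-].
by apply: CU; exists y => //; exact: DC.
Qed.

Lemma tends_extraction g C p phi :
  {homo phi : m n / (m < n)%N} -> tends g C p -> tends (g \o phi) C p.
Proof. by move=> hphi gC U /gC /(near_extraction hphi). Qed.

Lemma tends1P g x p : tends g [set x] p <-> act (g i) x @[i --> \oo] --> p.
Proof.
split=> h U /h hU.
  change (\forall i \near \oo, U (act (g i) x)).
  by apply: filterS hU => i; apply; exists x.
change (\forall i \near \oo, U (act (g i) x)) in hU.
by apply: filterS hU => i Ui _ [_ -> <-].
Qed.

Lemma tends_point g C x p : tends g C p -> C x -> tends g [set x] p.
Proof. by move=> gC Cx; apply: tends_sub gC => _ ->. Qed.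

Lemma tends_unique g x p q : tends g [set x] p -> tends g [set x] q -> p = q.
Proof.
move=> /tends1P hp /tends1P hq.
by apply: cvg_unique hp hq; exact: metric_hausdorff.
Qed.

Lemma tends_in_closed g x p (B : set X) : closed B ->
  (forall i, B (act (g i) x)) -> tends g [set x] p -> B p.
Proof.
move=> clB gB /tends1P hp; apply: (closed_cvg _ clB _ _ hp).
exact: nearW.
Qed.

Lemma tends_bigcup g (BB : set (set X)) p : finite_set BB ->
  (forall B, BB B -> tends g B p) -> tends g (\bigcup_(B in BB) B) p.
Proof.
move=> fBB hBB U pU.
have := near_finite_set fBB (fun B BBB => hBB B BBB U pU).
apply: filterS => i h _ [x [B BBB Bx] <-].
by apply: (h B BBB); exists x.
Qed.

End Tends.

(** * Diameters in a compact space *)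

Section Diameter.
Context {R : realType} {X : metricType R}.
Hypothesis cX : compact [set: X].

(** The [sup] in [diam] dominates the distances only if they are bounded. Otherwise points farther
    than [k] from [x0] would have a convergent subsequence. *)
Lemma mdist_bounded : exists M : R, forall x y : X, mdist x y <= M.
Proof.
have [[x0]|X0] := pselect (exists x0 : X, True); last first.
  by exists 0 => x; exfalso; apply: X0; exists x.
suff [M hM] : exists M : R, forall x : X, mdist x0 x <= M.
  exists (M + M) => x y; apply: le_trans (metric_triangle x x0 y) _.
  by rewrite lerD // metric_sym.
apply: contrapT => /forallNP h.
have /choice[u hu] : forall k : nat, exists x : X, k%:R < mdist x0 x.
  by move=> k; have /existsNP[x /negP] := h k%:R; rewrite -ltNge => ?; exists x.
have [phi hphi [p _ /cvg_ballP hp]] :=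
  compact_subsequence cX (fun i => I : setT (u i)).
near \oo => k.
have : ball p 1 (u (phi k)) by near: k; exact: hp.
rewrite ballEmdist /= ltNge => /negP; apply.
have h1 : mdist x0 p + 1 <= (phi k)%:R.
  apply: (@le_trans _ _ k%:R); last by rewrite ler_nat extraction_ge.
  by near: k; exact: nbhs_infty_ger.
have := metric_triangle x0 p (u (phi k)).
move=> /(lt_le_trans (hu (phi k))) /(le_lt_trans h1).
by rewrite ltrD2l => /ltW.
Unshelve. all: by end_near. Qed.

Lemma mdist_le_diam (A : set X) x y : A x -> A y -> mdist x y <= diam A.
Proof.
move=> Ax Ay; have [M hM] := mdist_bounded.
apply: ub_le_sup; last by exists x, y.
by exists M => _ [a [b [_ _ ->]]].
Qed.

End Diameter.

(** * Limiting behavior of a set under a sequence *)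

Section Dynamics.
Context {R : realType} {X : metricType R} {G : groupType}.
Variable act : G -> X -> X.
Hypothesis act1 : act 1%g = id.
Hypothesis actM : forall g h : G, act (g * h)%g = act g \o act h.
Hypothesis act_cont : forall g : G, continuous (act g).

Lemma actK k : cancel (act k) (act k^-1%g).
Proof.
by move=> x; rewrite -[LHS]/((act k^-1%g \o act k) x) -actM mulVg act1.
Qed.

Lemma actVK k : cancel (act k^-1%g) (act k).
Proof.
by move=> x; rewrite -[LHS]/((act k \o act k^-1%g) x) -actM mulgV act1.
Qed.

Lemma act_imageE k (A : set X) : act k @` A = act k^-1%g @^-1` A.
Proof.
apply/seteqP; split=> [_ [x Ax <-]|x Ax] /=; first by rewrite actK.
by exists (act k^-1%g x) => //; rewrite actVK.
Qed.

Lemma act_imageP k (A : set X) x : (act k @` A) x <-> A (act k^-1%g x).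
Proof. by rewrite act_imageE. Qed.

Lemma act_image_closed k (A : set X) : closed A -> closed (act k @` A).
Proof.
by rewrite act_imageE; apply: (continuous_closedP _).1 _; exact: act_cont.
Qed.

Lemma act_image_connected k (A : set X) :
  connected A -> connected (act k @` A).
Proof.
move=> cA; apply: connected_continuous_connected => //.
by apply: continuous_subspaceT; exact: act_cont.
Qed.

Lemma tends_shift k g C p :
  tends act g C p -> tends act (fun i => k * g i)%g C (act k p).
Proof.
move=> gC U /act_cont/gC; apply: filterS => i h _ [x Cx <-].
by rewrite actM; apply: h; exists x.
Qed.

(* Equivalently, the translates [(g 0)^-1 * g i] lie in the stabilizer of [A] and
   act on it as a convergence sequence with repeller [n]. *)
Definition dyn (g : nat -> G) (A : set X) (n p : X) : Prop :=
  [/\ forall i, act (g i) @` A = act (g 0%N) @` A, A n &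
      forall C, C `<=` A -> compact C -> ~ C n -> tends act g C p].

Lemma dyn_extraction g A n p phi : {homo phi : m n / (m < n)%N} ->
  dyn g A n p -> dyn (g \o phi) A n p.
Proof.
move=> hphi [gA An h]; split=> //; first by move=> i /=; rewrite !(gA (phi _)).
by move=> C CA cC Cn; apply: tends_extraction => //; exact: h.
Qed.

Lemma dyn_shift k g A n p :
  dyn g A n p -> dyn (fun i => k * g i)%g A n (act k p).
Proof.
move=> [gA An h]; split=> //.
  by move=> i; rewrite !actM -[LHS]image_comp gA image_comp.
by move=> C CA cC Cn; apply: tends_shift; exact: h.
Qed.

Lemma dyn_point g A n p x : dyn g A n p -> A x -> x <> n -> tends act g [set x] p.
Proof.
move=> [_ _ h] Ax xn; apply: h.
- by move=> _ ->.
- exact: compact_set1.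
- by move=> /= nx; apply: xn.
Qed.

Lemma dyn_image g A n p i x : dyn g A n p -> A x ->
  (act (g 0%N) @` A) (act (g i) x).
Proof. by move=> [gA _ _] Ax; rewrite -(gA i); exists x. Qed.

Definition typed (g : nat -> G) (A : set X) (p : X) : Prop :=
  tends act g A p \/ exists n, dyn g A n p.

Lemma typed_extraction g A p phi : {homo phi : m n / (m < n)%N} ->
  typed g A p -> typed (g \o phi) A p.
Proof.
move=> hphi [h|[n h]]; first by left; exact: tends_extraction.
by right; exists n; exact: dyn_extraction.
Qed.

Hypothesis lcX : locally_connected_space (X := X).

(** A connected neighborhood of [q] inside [V] eventually contains both images and misses that of
    [A]; its preimage joins [y1] to [y2] off [A]. *)
Lemma tends_not_separated g A V q y1 y2 :
  tends act g [set y1] q -> tends act g [set y2] q -> nbhs q V ->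
  (\forall i \near \oo, V `&` act (g i) @` A = set0) ->
  connected_component (~` A) y1 y2.
Proof.
move=> t1 t2 qV VA.
have [W [oW cW Wq WV]] := lcX qV.
have qW : nbhs q W by exact: open_nbhs_nbhs.
near \oo => i.
have W1 : W (act (g i) y1).
  have : act (g i) @` [set y1] `<=` W by near: i; exact: t1.
  by apply; exists y1.
have W2 : W (act (g i) y2).
  have : act (g i) @` [set y2] `<=` W by near: i; exact: t2.
  by apply; exists y2.
have VA0 : V `&` act (g i) @` A = set0 by near: i.
apply: (@connected_component_max _ _ (act (g i)^-1%g @` W)).
- by exists (act (g i) y1); rewrite ?actK.
- move=> _ [w Ww <-] Aw.
  have : (V `&` act (g i) @` A) w.
    by split; [exact: WV | apply/act_imageP].
  by rewrite VA0.
- exact: act_image_connected.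
- by exists (act (g i) y2); rewrite ?actK.
Unshelve. all: by end_near. Qed.

(** If [A] separated two points of [B], both would tend to [q], while [A] would move off a
    neighborhood of [q] when [p] and [q] differ. *)
Lemma crosses_tends g A B p q :
  tends act g A p -> tends act g B q -> crosses A B -> p = q.
Proof.
move=> gA gB [[c [Ac Bc]]|[AB _]].
  exact: tends_unique (tends_point gA Ac) (tends_point gB Bc).
have [y1 [y2 [By1 By2 _ _]]] := separates_points AB.
apply: contra_notP => pq; have [U [V [pU qV UV]]] := disjoint_nbhs pq.
apply: tends_not_separated (tends_point gB By1) (tends_point gB By2) qV _.
have := gA _ pU; apply: filterS => i gU; rewrite -subset0 => x [Vx /gU Ux].
by rewrite -UV.
Qed.

End Dynamics.

(** * Members of a pairing and their behavior on subsequences *)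

Section Pairing.
Context {R : realType} {X : metricType R} {G : groupType}.
Variable act : G -> X -> X.
Hypothesis act1 : act 1%g = id.
Hypothesis actM : forall g h : G, act (g * h)%g = act g \o act h.
Hypothesis act_cont : forall g : G, continuous (act g).
Hypothesis cX : compact [set: X].
Hypothesis lcX : locally_connected_space (X := X).
Variable AA : set (set X).
Hypothesis hclosed : forall A, AA A -> closed A.
Hypothesis hinv : forall (g : G) A, AA A -> AA (act g @` A).
Hypothesis hpair : local_convergence_pairing act AA.

Local Notation dyn := (dyn act).
Local Notation typed := (typed act).
Local Notation tends := (tends act).

Lemma AA_compact A : AA A -> compact A.
Proof. by move=> /hclosed clA; apply: subclosed_compact clA cX _. Qed.

Lemma AA_nonempty A : AA A -> A !=set0.
Proof. by case: hpair => h _ _ _ _ /h[a [_ [_ [Aa _ _ _]]]]; exists a. Qed.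

Lemma AA_avoid2 A (n m : X) : AA A -> exists x, [/\ A x, x <> n & x <> m].
Proof.
case: hpair => h _ _ _ _ /h[a [b [c [Aa Ab Ac [ab bc ac]]]]].
apply: contrapT => /forallNP H.
have eqnm x : A x -> x = n \/ x = m.
  move=> Ax; apply: contrapT => /not_orP[xn xm].
  by apply: (H x).
by case: (eqnm a Aa) (eqnm b Ab) (eqnm c Ac) => [?|?] [?|?] [?|?]; subst;
  try (by apply: ab); try (by apply: bc); by apply: ac.
Qed.

Lemma AA_avoid1 A (n : X) : AA A -> exists2 x, A x & x <> n.
Proof. by move=> /(AA_avoid2 n n)[x [Ax xn _]]; exists x. Qed.

(** Either one set is the image of [A] infinitely often, and condition (4) applies to translates in
    the stabilizer of [A], or no set is, and nullness makes the diameters of the images tend to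
    0. *)
Lemma typed_exists g A : injective g -> AA A ->
  exists2 phi, {homo phi : m n / (m < n)%N} & exists p, typed (g \o phi) A p.
Proof.
move=> ginj AAA; case: hpair => _ hnull _ hstab _.
have [[B /extraction[phi hphi gB]]|gsmall] :=
    pselect (exists B, ~ (\forall i \near \oo, ~ act (g i) @` A = B)).
  pose h k := ((g (phi 0))^-1 * g (phi k))%g.
  have hS k : Stab act A (h k).
    rewrite /Stab /= /h actM -image_comp gB -(gB 0%N) image_comp -actM mulVg act1.
    by rewrite image_id.
  have hinj : injective h.
    by move=> i j /mulgI/ginj/(extraction_inj hphi).
  have [psi [hpsi [n [p [An Ap hconv]]]]] := hstab A AAA h hS hinj.
  exists (phi \o psi); first by move=> i j /hpsi/hphi.
  exists (act (g (phi 0%N)) p); right; exists n; split=> //.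
    by move=> i /=; rewrite !gB.
  move=> C CA cC Cn.
  have -> : g \o (phi \o psi) = (fun i => g (phi 0%N) * (h \o psi) i)%g.
    by apply/funext => i /=; rewrite /h mulgA mulgV mul1g.
  apply: tends_shift => // U pU.
  have [N hN] := hconv C CA cC Cn U pU.
  by exists N => // i /= /hN h' x /h'[].
have hdiam (e : R) : 0 < e -> \forall i \near \oo, diam (act (g i) @` A) <= e.
  move=> e0.
  have := near_finite_set (hnull e e0)
    (P := fun B i => ~ act (g i) @` A = B).
  have H B : [set B | AA B /\ e < diam B] B ->
      \forall i \near \oo, act (g i) @` A <> B.
    by move=> _; apply: contrapT => hB; apply: gsmall; exists B.
  move=> /(_ H); apply: filterS => i hi.
  rewrite leNgt; apply/negP => lt; apply: (hi (act (g i) @` A)) => //.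
  by split => //; exact: hinv.
(* As the diameters tend to 0, a limit of the images of one point attracts all of [A]. *)
have [a Aa] := AA_nonempty AAA.
have [phi hphi [p _ /cvg_ballP hp]] :=
  compact_subsequence cX (fun i => I : setT (act (g i) a)).
exists phi => //; exists p; left => U /nbhs_ballP[e /= e0 peU].
have e20 : 0 < e / 2 by rewrite divr_gt0.
have h1 := near_extraction hphi (hdiam _ e20).
apply: filterS2 h1 (hp _ e20) => i h1 h2 _ [x Ax <-].
apply: peU; move: h2; rewrite !ballEmdist /= => h2.
apply: le_lt_trans (metric_triangle p (act (g (phi i)) a) _) _.
rewrite [e]splitr ltr_leD //; apply: le_trans h1.
exact: mdist_le_diam.
Qed.

Lemma typed_seq g (s : seq (set X)) : injective g ->
  (forall A, A \in s -> AA A) ->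
  exists2 phi, {homo phi : m n / (m < n)%N} &
    forall A, A \in s -> exists p, typed (g \o phi) A p.
Proof.
move=> ginj; elim: s => [|A s IHs] hs.
  by exists id => // A; rewrite in_nil.
have [|phi hphi IH] := IHs.
  by move=> B Bs; apply: hs; rewrite inE Bs orbT.
have gphi_inj : injective (g \o phi).
  by move=> i j /ginj/(extraction_inj hphi).
have [psi hpsi [p hp]] := typed_exists gphi_inj (hs A (mem_head _ _)).
exists (phi \o psi); first by move=> i j /hpsi/hphi.
move=> B; rewrite inE => /orP[/eqP ->|/IH[q hq]]; first by exists p.
by exists q; exact: (typed_extraction hpsi hq).
Qed.

(** * Attractor and repeller on a set with constant image *)

Lemma dyn_attractor g A n p : AA A -> dyn g A n p -> (act (g 0%N) @` A) p.
Proof.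
move=> AAA gA; have [x Ax xn] := AA_avoid1 n AAA.
apply: (tends_in_closed _ _ (dyn_point gA Ax xn)).
  by apply: act_image_closed => //; exact: hclosed.
by move=> i; exact: dyn_image gA Ax.
Qed.

(** The part of [A] outside a neighborhood [V] of [n] is compact, so it is carried towards [p] and
    off [C]. As [A] is invariant, the preimages of [C] then lie in [V]. *)
Lemma dyn_inv g A n p : AA A -> (forall i, act (g i) @` A = A) ->
  dyn g A n p -> dyn (fun i => (g i)^-1)%g A p n.
Proof.
move=> AAA gA dA; have [_ An h] := dA.
have gVA i : act (g i)^-1%g @` A = A.
  by rewrite -{1}(gA i) image_comp -actM mulVg act1 image_id.
have Ap : A p by rewrite -(gA 0%N); exact: (dyn_attractor AAA dA).
split=> //; first by move=> i; rewrite !gVA.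
move=> C CA cC Cp U; rewrite nbhsE => -[V [oV Vn] VU].
have : tends g (A `&` ~` V) p.
  apply: h => //; last by case.
  by apply: subclosed_compact (closedI (hclosed AAA) (open_closedC oV)) cX _.
move=> /(_ (~` C)) []; first by apply: open_nbhs_nbhs; split => //;
  apply: closed_openC; apply: compact_closed => //; exact: metric_hausdorff.
move=> N _ HN; exists N => // i Ni _ [c Cc <-]; apply: VU.
apply: contrapT => Vc; apply: (HN i Ni c) => //.
exists (act (g i)^-1%g c); last by rewrite actVK.
by split=> //; rewrite -(gVA i); exists c => //; exact: CA.
Qed.

(** If [n] were isolated in [A], all of the constant image except [act (g i) n] would crowd at [p].
    But that image has two distinct points other than [p], because members have more than two
    points. *)
Lemma dyn_nonisolated g A n p V : AA A -> dyn g A n p -> nbhs n V ->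
  exists z, [/\ A z, V z & z <> n].
Proof.
move=> AAA dA nV; apply: contrapT => /forallNP Vn; have [gA An h] := dA.
have := nV; rewrite nbhsE => -[W [oW Wn] WV].
have t : tends g (A `&` ~` W) p.
  apply: h => //; last by case.
  by apply: subclosed_compact (closedI (hclosed AAA) (open_closedC oW)) cX _.
have AAgA : AA (act (g 0%N) @` A) by exact: hinv.
have [z [gAz zp _]] := AA_avoid2 p p AAgA.
have [y [gAy yp yz]] := AA_avoid2 p z AAgA.
have pz : nbhs p (~` [set z]) by apply: nbhs_neq => ?; exact: zp.
have py : nbhs p (~` [set y]) by apply: nbhs_neq => ?; exact: yp.
near \oo => i.
have H x : (act (g 0%N) @` A) x -> ~ (act (g i) @` (A `&` ~` W)) x ->
    x = act (g i) n.
  rewrite -(gA i) => -[a Aa <-] aW; congr act.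
  apply: contrapT => an; apply: aW; exists a => //; split=> // Wa.
  by apply: (Vn a); split=> //; exact: WV.
have Ey : y = act (g i) n.
  apply: H => // yW.
  have : act (g i) @` (A `&` ~` W) `<=` ~` [set y] by near: i; exact: t.
  by move=> /(_ _ yW); apply.
have Ez : z = act (g i) n.
  apply: H => // zW.
  have : act (g i) @` (A `&` ~` W) `<=` ~` [set z] by near: i; exact: t.
  by move=> /(_ _ zW); apply.
by apply: yz; rewrite Ey -Ez.
Unshelve. all: by end_near. Qed.

(** Components of the complement of [B] are open and [n] is not isolated in [A], so a separated
    point equal to [n] can be moved off it within its component. *)
Lemma dyn_separated_points g A B n p : AA A -> AA B -> dyn g A n p ->
  separates B A -> exists y1 y2,
    [/\ A y1 /\ y1 <> n, A y2 /\ y2 <> n & ~ connected_component (~` B) y1 y2].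
Proof.
move=> AAA AAB dA /separates_points[y1 [y2 [Ay1 Ay2 By1 By2 H]]].
have move_off y : A y -> ~ B y ->
    exists z, [/\ A z, z <> n & connected_component (~` B) y z].
  move=> Ay By; have yB := nbhs_connected_component lcX (hclosed AAB) By.
  have [yn|yn] := pselect (y = n).
    rewrite -yn in dA.
    by have [z [Az Bz zy]] := dyn_nonisolated AAA dA yB; exists z; rewrite -yn.
  by exists y; split=> //; exact: connected_component_refl.
have [z1 [Az1 zn1 yz1]] := move_off _ Ay1 By1.
have [z2 [Az2 zn2 yz2]] := move_off _ Ay2 By2.
exists z1, z2; split=> // zz; apply: H.
apply: connected_component_trans yz1 _; apply: connected_component_trans zz _.
exact: connected_component_sym.
Qed.

(** * Attractors of crossing sets *)

Lemma dyn_tends_separated g A B n p q : AA A -> AA B -> dyn g A n p ->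
  tends g B q -> separates B A -> p = q.
Proof.
move=> AAA AAB dA gB BA.
have [y1 [y2 [[Ay1 yn1] [Ay2 yn2] H]]] := dyn_separated_points AAA AAB dA BA.
apply: contra_notP H => pq; have [U [V [pU qV UV]]] := disjoint_nbhs pq.
apply: (tends_not_separated act1 actM act_cont lcX
  (dyn_point dA Ay1 yn1) (dyn_point dA Ay2 yn2) pU).
have := gB _ qV; apply: filterS => i gV; rewrite -subset0 => x [Ux /gV Vx].
by rewrite -UV.
Qed.

Lemma dyn_tends_crosses g A B n p q : AA A -> AA B -> dyn g A n p ->
  tends g B q -> crosses A B -> ~ B n -> p = q.
Proof.
move=> AAA AAB dA gB [[c [Ac Bc]] Bn|[_ BA] _]; last first.
  exact: (dyn_tends_separated AAA AAB dA gB BA).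
apply: tends_unique (dyn_point dA Ac _) (tends_point gB Bc).
by move=> cn; apply: Bn; rewrite -cn.
Qed.

Lemma dyn_tends_mem g A B n p q : AA A -> AA B -> dyn g A n p ->
  tends g B q -> crosses A B -> (act (g 0%N) @` A) q.
Proof.
move=> AAA AAB dA gB [[c [Ac Bc]]|[_ BA]]; last first.
  rewrite -(dyn_tends_separated AAA AAB dA gB BA).
  exact: (dyn_attractor AAA dA).
apply: (tends_in_closed _ _ (tends_point gB Bc)).
  by apply: act_image_closed => //; exact: hclosed.
by move=> i; exact: dyn_image dA Ac.
Qed.

(** In the separation case [p] lies in the constant image of [B]: otherwise that image stays off a
    neighborhood of [p], to which two points of [A] separated by [B] both tend. Pulling [p] back by
    [g 0] gives a common point. *)
Lemma dyn_dyn_meet g A B n p m q : AA A -> AA B -> dyn g A n p ->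
  dyn g B m q -> crosses A B -> A `&` B !=set0.
Proof.
move=> AAA AAB dA dB [//|[_ BA]].
have [y1 [y2 [[Ay1 yn1] [Ay2 yn2] H]]] := dyn_separated_points AAA AAB dA BA.
have [Bp|Bp] := pselect ((act (g 0%N) @` B) p).
  have Ap := dyn_attractor AAA dA.
  by exists (act (g 0%N)^-1%g p); split; apply/(act_imageP act1 actM).
exfalso; apply: H.
apply: (tends_not_separated act1 actM act_cont lcX
  (dyn_point dA Ay1 yn1) (dyn_point dA Ay2 yn2) (V := ~` (act (g 0%N) @` B))).
  apply: open_nbhs_nbhs; split => //; apply: closed_openC.
  by apply: act_image_closed => //; exact: hclosed.
apply: nearW => i; have [gB _ _] := dB.
by rewrite gB setICl.
Qed.

Lemma dyn_dyn_mem g A B n p m q : AA A -> AA B -> dyn g A n p ->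
  dyn g B m q -> crosses A B -> ~ A m -> (act (g 0%N) @` A) q.
Proof.
move=> AAA AAB dA dB AB Am.
have [c [Ac Bc]] := dyn_dyn_meet AAA AAB dA dB AB.
have cm : c <> m by move=> cm; apply: Am; rewrite -cm.
apply: (tends_in_closed _ _ (dyn_point dB Bc cm)).
  by apply: act_image_closed => //; exact: hclosed.
by move=> i; exact: dyn_image dA Ac.
Qed.

(** * Crossing sequences that avoid the repeller *)

Lemma chain_tends g B m q D r : AA B -> dyn g B m q ->
  tends (fun i => (g i)^-1)%g [set q] r -> D m -> D r ->
  forall s A, (forall C, C \in A :: s ->
    [/\ AA C, D `&` C = set0 & exists p, typed g C p]) ->
  crossing_chain A (rcons s B) -> tends g A q.
Proof.
move=> AAB dB gr Dm Dr.
(* If [q] were in the constant image of [A], its preimages and hence their limit [r] would lie in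
   [A], which [D] forbids. *)
have absurd A n p : AA A -> D `&` A = set0 -> dyn g A n p ->
    ~ (act (g 0%N) @` A) q.
  move=> AAA DA [gA _ _] Aq.
  suff Ar : A r by have : (D `&` A) r by [] ; rewrite DA.
  apply: (tends_in_closed (hclosed AAA) _ gr) => i.
  by apply/(act_imageP act1 actM); rewrite gA.
(* Collapse to [q] spreads backwards, starting from the set that crosses [B]. *)
elim=> [|A' s IHs] A hs /=.
  move=> [AB _]; have [AAA DA [p [gA|[n dA]]]] := hs A (mem_head _ _); last first.
    exfalso; apply: (absurd A n p AAA DA dA).
    apply: (dyn_dyn_mem AAA AAB dA dB AB) => Am.
    by have : (D `&` A) m by [] ; rewrite DA.
  suff -> : q = p by [].
  apply: (dyn_tends_crosses AAB AAA dB gA (crossesC AB)) => Am.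
  by have : (D `&` A) m by [] ; rewrite DA.
move=> [AA' chainA'].
have gA' : tends g A' q.
  by apply: IHs => // C Cs; apply: hs; rewrite inE Cs orbT.
have [AAA DA [p [gA|[n dA]]]] := hs A (mem_head _ _); last first.
  exfalso; apply: (absurd A n p AAA DA dA).
  have [AAA' _ _] : [/\ AA A', D `&` A' = set0 & exists p, typed g A' p].
    by apply: hs; rewrite !inE eqxx orbT.
  exact: (dyn_tends_mem AAA AAA' dA gA' AA').
by rewrite -(crosses_tends act1 actM act_cont lcX gA gA' AA').
Qed.

(* A crossing sequence that avoids both the repeller [m] of [B] and the limit
   [r] of the preimages of its attractor consists of sets shrinking to [q]:
   a set of the sequence with constant image would contain [r]. *)
Lemma avoiding_seq_attractor g A B m p q D r : injective g ->
  AA A -> AA B -> dyn g B m q ->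
  tends (fun i => (g i)^-1)%g [set q] r -> D m -> D r ->
  tends g A p \/ (exists2 n, dyn g A n p & D n) ->
  crossing_seq_avoiding AA A B D -> p = q.
Proof.
move=> ginj AAA AAB dB gr Dm Dr hA [s0 [+ + +]].
case: s0 => [//|A1 s] _ hs /= [AA1 chA1].
have AA_hs C : C \in A1 :: s -> AA C by case/hs.
have [phi hphi hphis] := typed_seq ginj AA_hs.
have gA1 : tends (g \o phi) A1 q.
  apply: (chain_tends AAB (dyn_extraction hphi dB)
    (tends_extraction hphi gr) Dm Dr (s := s)) => // C Cs.
  by have [AAC DC] := hs C Cs; split=> //; exact: hphis.
have [AAA1 DA1] := hs A1 (mem_head _ _).
case: hA => [gA|[n dA Dn]].
  exact: (crosses_tends act1 actM act_cont lcX (tends_extraction hphi gA) gA1).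
apply: (dyn_tends_crosses AAA AAA1 (dyn_extraction hphi dA) gA1 AA1) => A1n.
by have : (D `&` A1) n by [] ; rewrite DA1.
Qed.

Lemma avoiding_seq1 A B c b : AA A -> AA B -> A `&` B = [set c] ->
  B b -> b <> c -> crossing_seq_avoiding AA A B [set b; c].
Proof.
by case: hpair => _ _ _ _ h AAA AAB AB Bb bc; apply: (h A B AAA AAB).1.
Qed.

Lemma avoiding_seq02 A B : AA A -> AA B ->
  A `&` B = set0 \/ (exists c1 c2 : X, c1 <> c2 /\ A `&` B = [set c1; c2]) ->
  crossing_seq_avoiding AA A B (A `&` B).
Proof. by case: hpair => _ _ _ _ h AAA AAB; exact: (h A B AAA AAB).2. Qed.

Lemma inverse_orbit_limit g A n p q : AA A -> dyn g A n p ->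
  (act (g 0%N) @` A) q ->
  exists2 phi, {homo phi : m n / (m < n)%N} &
    exists2 r, A r & tends ((fun i => (g i)^-1)%g \o phi) [set q] r.
Proof.
move=> AAA [gA _ _] Aq.
have Agq i : A (act (g i)^-1%g q) by apply/(act_imageP act1 actM); rewrite gA.
have [phi hphi [r Ar hr]] := compact_subsequence (AA_compact AAA) Agq.
by exists phi => //; exists r => //; apply/tends1P.
Qed.

Lemma inj_extraction (g : nat -> G) phi : {homo phi : m n / (m < n)%N} ->
  injective g -> injective (g \o phi).
Proof. by move=> hphi ginj i j /ginj/(extraction_inj hphi). Qed.

(** Suppose [n] is in [B] and [p] differs from [q]. A common point other than [n] would tend to
    both, so the sets meet exactly at [n], and the first half of condition (5) gives a crossing
    sequence avoiding [n] and one chosen point of [A]. *)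
Lemma dyn_tends_attractor g A B n p q : injective g -> AA A -> AA B ->
  dyn g A n p -> tends g B q -> crosses A B -> p = q.
Proof.
move=> ginj AAA AAB dA gB AB.
have [Bn|Bn] := pselect (B n); last exact: (dyn_tends_crosses AAA AAB dA gB AB).
apply: contrapT => pq.
have AnB : B `&` A = [set n].
  apply/seteqP; split=> [x [Bx Ax]|_ ->]; last by split=> //; case: dA.
  apply: contrapT => xn; apply: pq.
  exact: tends_unique (dyn_point dA Ax xn) (tends_point gB Bx).
have [phi hphi [r Ar gr]] := inverse_orbit_limit AAA dA (dyn_attractor AAA dA).
(* The chosen point is [r], unless [r] is [n] and so already avoided. *)
have [b [Ab bn rb]] : exists b, [/\ A b, b <> n & [set b; n] r].
  have [->|rn] := pselect (r = n).
    by have [b Ab bn] := AA_avoid1 n AAA; exists b; split=> //; right.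
  by exists r; split=> //; left.
apply/pq/esym.
apply: (avoiding_seq_attractor (inj_extraction hphi ginj) AAB AAA
  (dyn_extraction hphi dA) gr (D := [set b; n])) => //.
- by right.
- by left; exact: tends_extraction.
- exact: avoiding_seq1.
Qed.

(** If [p] and [q] differ, the sets meet only at repellers. [D] must contain [n], [m] and [r]; which
    half of condition (5) supplies it depends on whether [m] is [n] and whether [A] contains [m]. *)
Lemma dyn_dyn_attractor_repeller g A B n p m q : injective g -> AA A -> AA B ->
  dyn g A n p -> dyn g B m q -> B n -> p = q.
Proof.
move=> ginj AAA AAB dA dB Bn; apply: contrapT => pq.
have An : A n by case: dA.
have ABnm x : (A `&` B) x -> x = n \/ x = m.
  move=> [Ax Bx]; apply: contrapT => /not_orP[xn xm]; apply: pq.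
  exact: tends_unique (dyn_point dA Ax xn) (dyn_point dB Bx xm).
have [phi hphi [r Br gr]] := inverse_orbit_limit AAB dB (dyn_attractor AAB dB).
suff [D [Dn Dm Dr chD]] : exists D,
    [/\ D n, D m, D r & crossing_seq_avoiding AA A B D].
  apply: pq; apply: (avoiding_seq_attractor (inj_extraction hphi ginj) AAA AAB
    (dyn_extraction hphi dB) gr Dm Dr) => //.
  by right; exists n => //; exact: dyn_extraction.
have [mn|mn] := pselect (m = n).
  have ABn : A `&` B = [set n].
    by apply/seteqP; split=> [x /ABnm[]|_ ->//] ->.
  have [b [Bb bn rb]] : exists b, [/\ B b, b <> n & [set b; n] r].
    have [->|rn] := pselect (r = n).
      by have [b Bb bn] := AA_avoid1 n AAB; exists b; split=> //; right.
    by exists r; split=> //; left.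
  exists [set b; n]; split=> //; [by right|by rewrite mn; right|].
  exact: avoiding_seq1.
have nm : n <> m by move=> /esym.
(* Not being the repeller of [B], the point [n] tends to [q] inside the constant image of [A]. Hence
   [r] is in [A] too, so it is [n] or [m]. *)
have gnq := dyn_point dB Bn nm.
have Aq : (act (g 0%N) @` A) q.
  apply: (tends_in_closed _ _ gnq).
    by apply: act_image_closed => //; exact: hclosed.
  by move=> i; exact: dyn_image dA An.
have Ar : A r.
  apply: (tends_in_closed (hclosed AAA) _ gr) => i /=.
  by apply/(act_imageP act1 actM); have [-> _ _] := dA.
have rnm : [set m; n] r by have [->|->] := ABnm r (conj Ar Br); [right|left].
have [Am|Am] := pselect (A m).
  have ABE : A `&` B = [set n; m].
    apply/seteqP; split=> [x /ABnm[]->|x [->|->]]; [by left|by right|by []|].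
    by split=> //; case: dB.
  exists (A `&` B); split.
  - by split.
  - by rewrite ABE; right.
  - by [].
  - by apply: avoiding_seq02 => //; right; exists n, m.
have ABE : A `&` B = [set n].
  apply/seteqP; split=> [x ABx|_ ->//]; have [//|xm] := ABnm x ABx.
  by case: ABx => Ax _; rewrite xm in Ax.
(* Here [m] is the chosen point in condition (5). *)
exists [set m; n]; split=> //; [by right|by left|].
by apply: avoiding_seq1 => //; case: dB.
Qed.

Lemma dyn_dyn_attractor g A B n p m q : injective g -> AA A -> AA B ->
  dyn g A n p -> dyn g B m q -> crosses A B -> p = q.
Proof.
move=> ginj AAA AAB dA dB AB.
have [c [Ac Bc]] := dyn_dyn_meet AAA AAB dA dB AB.
have [Bn|Bn] := pselect (B n).
  exact: (dyn_dyn_attractor_repeller ginj AAA AAB dA dB).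
have [Am|Am] := pselect (A m).
  by rewrite (dyn_dyn_attractor_repeller ginj AAB AAA dB dA).
apply: tends_unique (dyn_point dA Ac _) (dyn_point dB Bc _) => cE.
  by apply: Bn; rewrite -cE.
by apply: Am; rewrite -cE.
Qed.

Lemma typed_crosses g A B p q : injective g -> AA A -> AA B ->
  typed g A p -> typed g B q -> crosses A B -> p = q.
Proof.
move=> ginj AAA AAB [gA|[n dA]] [gB|[m dB]] AB.
- exact: (crosses_tends act1 actM act_cont lcX gA gB).
- exact/esym/(dyn_tends_attractor ginj AAB AAA dB gA)/crossesC.
- exact: (dyn_tends_attractor ginj AAA AAB dA gB).
- exact: (dyn_dyn_attractor ginj AAA AAB dA dB).
Qed.

(** * Uniqueness of the attractor and of the repeller *)

Lemma typed_chain g s A B p q : injective g -> AA A -> AA B ->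
  typed g A p -> typed g B q ->
  (forall C, C \in s -> AA C /\ exists r, typed g C r) ->
  crossing_chain A (rcons s B) -> p = q.
Proof.
move=> ginj; elim: s A p => [|C s IHs] A p AAA AAB gA gB hs /= [AC chC].
  exact: (typed_crosses ginj AAA AAB gA gB).
have [AAC [r gC]] := hs C (mem_head _ _).
rewrite (typed_crosses ginj AAA AAC gA gC AC).
by apply: (IHs C r) => // D Ds; apply: hs; rewrite inE Ds orbT.
Qed.

(** Condition (5) joins disjoint members by a crossing sequence. On a subsequence all its terms have
    attractors, which agree across each crossing. *)
Lemma typed_unique g A B p q : injective g -> AA A -> AA B ->
  typed g A p -> typed g B q -> p = q.
Proof.
move=> ginj AAA AAB gA gB.
have [AB0|/eqP/set0P AB] := pselect (A `&` B = set0); last first.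
  by apply: (typed_crosses ginj AAA AAB gA gB); left.
have [s [_ hs chs]] := avoiding_seq02 AAA AAB (or_introl AB0).
have [|phi hphi hphis] := typed_seq ginj (s := s); first by move=> C /hs[].
apply: (typed_chain (inj_extraction hphi ginj) AAA AAB
  (typed_extraction hphi gA) (typed_extraction hphi gB) _ chs).
by move=> C Cs; split; [case: (hs C Cs) | exact: hphis].
Qed.

(** Repellers are attractors of the inverses. The single factor [k] makes [A] and [B] both invariant
    and keeps their repellers, so [dyn_inv] applies to both. *)
Lemma dyn_repeller_unique g A B n p m q : injective g -> AA A -> AA B ->
  dyn g A n p -> dyn g B m q -> n = m.
Proof.
move=> ginj AAA AAB dA dB; pose k := ((g 0%N)^-1)%g.
have stable C l r : dyn g C l r -> forall i, act (k * g i)%g @` C = C.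
  move=> [gC _ _] i.
  by rewrite actM -image_comp gC image_comp -actM mulVg act1 image_id.
have dAV := dyn_inv AAA (stable _ _ _ dA) (dyn_shift actM act_cont k dA).
have dBV := dyn_inv AAB (stable _ _ _ dB) (dyn_shift actM act_cont k dB).
have inj : injective (fun i => (k * g i)^-1)%g.
  by move=> i j /invg_inj/mulgI/ginj.
apply: (typed_unique inj AAA AAB); first by right; exists (act k p).
by right; exists (act k q).
Qed.

(** * Convergence on the whole space *)

(** This serves both when some member does not collapse, with [n] its repeller, and when all
    collapse, with [n] a limit of preimages of [z]. The hypothesis on subsequences forces members
    that miss [n] to collapse. *)
Lemma convergence_criterion g A p n z : (forall x : X, ~ cut_point x) ->
  injective g -> AA A -> typed g A p ->
  z <> p -> tends (fun i => (g i)^-1)%g [set z] n ->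
  (forall phi B m q, {homo phi : i j / (i < j)%N} -> AA B ->
    dyn (g \o phi) B m q -> m = n) ->
  forall C, compact C -> ~ C n -> tends g C p.
Proof.
move=> hcut ginj AAA gA zp gz repn C cC Cn U pU; apply: contrapT => gCU.
have [phi1 hphi1 gphi1] : exists2 phi, {homo phi : i j / (i < j)%N} &
    forall k, ~ (act (g (phi k)) @` C `<=` U).
  apply: (@extraction (fun i => ~ (act (g i) @` C `<=` U))) => h; apply: gCU.
  by apply: filterS h => i /contrapT.
(* Points of [C] sent outside [U] subconverge to some [yl], and their images to some [wl] other than
   [p]. *)
have /choice[y hy] : forall k, exists y, C y /\ ~ U (act (g (phi1 k)) y).
  move=> k; apply: contrapT => /forallNP h; apply: (gphi1 k) => _ [y Cy <-].
  by apply: contrapT => Uy; apply: (h y).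
have [phi2 hphi2 [yl Cyl yyl]] := compact_subsequence cC (fun i => (hy i).1).
pose w k := act (g (phi1 (phi2 k))) (y (phi2 k)).
have [phi3 hphi3 [wl _ wwl]] := compact_subsequence cX (fun i => I : setT (w i)).
have wlp : wl <> p.
  move=> wlp; rewrite {}wlp in wwl.
  have [N _ /(_ N (leqnn N))] := wwl _ pU.
  exact: (hy _).2.
have nyl : n <> yl by move=> nyl; apply: Cn; rewrite nyl.
case: hpair => _ _ /(_ n yl nyl)[BB [fBB BBAA [nS yS _ _ sep]]] _ _.
have {}nS := nS n erefl; have {}yS := yS yl erefl.
have {}sep := sep n yl erefl erefl.
have hphi : {homo phi1 \o phi2 \o phi3 : i j / (i < j)%N}.
  by move=> i j /hphi3/hphi2/hphi1.
have /finite_seqP[s BBs] := fBB.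
have [|phi4 hphi4 hphi4s] := typed_seq (inj_extraction hphi ginj) (s := s).
  by move=> B Bs; apply: BBAA; rewrite BBs.
pose theta := phi1 \o phi2 \o phi3 \o phi4.
have htheta : {homo theta : i j / (i < j)%N} by move=> i j /hphi4/hphi.
pose S := \bigcup_(B in BB) B.
have clS : closed S.
  by apply: closed_bigcup => // B /BBAA/hclosed.
have gS : tends (g \o theta) S p.
  apply: tends_bigcup => // B BBB.
  have Bs : B \in s by rewrite BBs in BBB.
  have [q hq] := hphi4s B Bs.
  have pq : p = q.
    apply: (typed_unique (inj_extraction htheta ginj) AAA (BBAA B BBB)) hq.
    exact: typed_extraction htheta gA.
  (* A non-collapsed [B] would contain [n] as its repeller. *)
  rewrite pq; case: hq => // -[m dB]; exfalso; apply: nS.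
  exists B => //; rewrite -(repn _ _ _ _ htheta (BBAA B BBB) dB).
  by case: dB.
have [K [cK Kz wK [V pV VK]]] := connected_avoiding lcX (hcut p) zp wlp.
apply: sep.
pose u i := y (phi2 (phi3 (phi4 i))).
near \oo => i.
have nx : connected_component (~` S) n (act (g (theta i))^-1%g z).
  near: i; apply: (near_extraction htheta (P := fun j =>
    connected_component (~` S) n (act (g j)^-1%g z))).
  by apply: ((tends1P _ _ _ _).1 gz); exact: nbhs_connected_component.
have ylu : connected_component (~` S) yl (u i).
  near: i; apply: (near_extraction hphi4 (P := fun j =>
    connected_component (~` S) yl (y (phi2 (phi3 j))))).
  apply: (near_extraction hphi3 (P := fun j =>
    connected_component (~` S) yl (y (phi2 j)))).
  by apply: yyl; exact: nbhs_connected_component.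
have Ku : K (act (g (theta i)) (u i)).
  near: i; apply: (near_extraction hphi4 (P := fun j => K (w (phi3 j)))).
  exact: wwl.
have gSV : act (g (theta i)) @` S `<=` V by near: i; exact: gS.
apply: connected_component_trans nx _.
apply: connected_component_trans (connected_component_sym ylu).
(* The pullback of [K] joins the preimage of [z] to [u i], and misses [S] because the image of [S]
   lies in [V]. *)
apply: (@connected_component_max _ _ (act (g (theta i))^-1%g @` K)).
- by exists z.
- move=> _ [k Kk <-] Sk; have : (V `&` K) k; last by rewrite VK.
  by split=> //; apply: gSV; apply/(act_imageP act1 actM).
- exact: act_image_connected.
- by exists (act (g (theta i)) (u i)) => //; rewrite actK.
Unshelve. all: by end_near. Qed.

Lemma AA_exists : connected [set: X] -> forall x y : X, x <> y ->
  exists A, AA A.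
Proof.
move=> coX x y xy; case: hpair => _ _ /(_ x y xy)[BB [_ BBAA [_ _ _ _ sep]]] _ _.
apply: contrapT => /forallNP noA; apply: (sep x y) => //.
have -> : \bigcup_(B in BB) B = set0.
  by rewrite -subset0 => t [B /BBAA/noA].
by rewrite setC0 connected_component_id.
Qed.

Lemma pairing_convergence : connected [set: X] ->
  (forall x : X, ~ cut_point x) ->
  forall (x0 : X) (g : nat -> G), injective g ->
  exists2 phi, {homo phi : i j / (i < j)%N} &
    exists n p, forall C, compact C -> ~ C n -> tends (g \o phi) C p.
Proof.
move=> coX hcut x0 g ginj.
have [x0E|/existsNP[y0 y0x]] := pselect (forall y, y = x0).
  exists id => //; exists x0, x0 => C _ _ U /nbhs_singleton Ux.
  by apply: nearW => i _ [x _ <-]; rewrite (x0E (act _ x)).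
have [A0 AAA0] := AA_exists coX y0x.
have [[A [n [p [phi [hphi AAA dA]]]]]|nodyn] := pselect (exists A n p phi,
    [/\ {homo phi : i j / (i < j)%N}, AA A & dyn (g \o phi) A n p]).
  have phi_inj := inj_extraction hphi ginj.
  (* Preimages of a point of the constant image other than [p] tend to [n], by [dyn_inv]. *)
  have [z gAz zp] := AA_avoid1 p (hinv (g (phi 0%N)) AAA).
  exists phi => //; exists n, p.
  apply: (convergence_criterion hcut phi_inj AAA _ zp).
  - by right; exists n.
  - pose k := ((g (phi 0%N))^-1)%g.
    have [gA An _] := dA.
    have stable i : act (k * (g \o phi) i)%g @` A = A.
      by rewrite actM -image_comp gA image_comp -actM mulVg act1 image_id.
    have dV := dyn_inv AAA stable (dyn_shift actM act_cont k dA).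
    have kz : A (act k z) by apply/(act_imageP act1 actM).
    have kzp : act k z <> act k p.
      by move=> /(can_inj (actK act1 actM k)).
    have := dyn_point dV kz kzp => t U /t; apply: filterS => i h _ [_ -> <-].
    apply: h; exists (act k z) => //.
    by rewrite invgM actM /= (actK act1 actM).
  - move=> psi B m q hpsi AAB dB; apply/esym.
    exact: (dyn_repeller_unique (inj_extraction hpsi phi_inj) AAA AAB
      (dyn_extraction hpsi dA) dB).
(* With no constant images on any subsequence, [z] may be any point other than [p], and [n] any
   subsequential limit of its preimages. *)
have [phi hphi [p hp]] := typed_exists ginj AAA0.
have [z zp] : exists z, z <> p.
  have [<-|] := pselect (x0 = p); first by exists y0.
  by exists x0.
have [psi hpsi [n _ hn]] := compact_subsequence cX
  (fun i => I : setT (act (g (phi i))^-1%g z)).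
have h : {homo phi \o psi : i j / (i < j)%N} by move=> i j /hpsi/hphi.
exists (phi \o psi) => //; exists n, p.
apply: (convergence_criterion hcut (inj_extraction h ginj) AAA0
  (typed_extraction hpsi hp) zp).
  exact/tends1P.
move=> chi B m q hchi AAB dB; exfalso; apply: nodyn.
by exists B, m, q, (phi \o psi \o chi); split=> // i j /hchi/h.
Qed.

End Pairing.

Theorem theorem4p10 (R : realType) (X : metricType R) (G : groupType)
  (act : G -> X -> X)
  (act1 : act 1%g = id)
  (actM : forall g h : G, act (g * h)%g = act g \o act h)
  (act_cont : forall g : G, continuous (act g))
  (AA : set (set X))
  (hX : peano_continuum (X := X))
  (hcut : forall x : X, ~ cut_point x)
  (hclosed : forall A, AA A -> closed A)
  (hinv : forall (g : G) A, AA A -> AA (act g @` A))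
  (hpair : local_convergence_pairing act AA) :
  convergence_group_on act [set: G] [set: X].
Proof.
move=> g _ ginj; have [[x0 _] cX coX lcX] := hX.
have [phi hphi [n [p hC]]] := pairing_convergence act1 actM act_cont cX lcX
  hclosed hinv hpair coX hcut x0 ginj.
exists phi; split=> //; exists n, p; split=> // C _ cC Cn U pU.
have [N _ HN] := hC C cC Cn U pU.
by exists N => i Ni; rewrite setIT; exact: HN.
Qed.
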